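(* Let $d\ge 1$ and $n\ge 1$ be integers, and let $g\in\mathbb{R}[x_1,\dots,x_d]$ be a form (homogeneous polynomial) of degree $2n$ such that $g(\mathbf{x})\ge 0$ for all $\mathbf{x}\in\mathbb{R}^d$ and $g(\mathbf{x})=0$ only if $\mathbf{x}=0$. Let $\mu$ be the measure on $\mathbb{R}^d$ with $d\mu(\mathbf{x})=\exp(-g(\mathbf{x}))\,d\mathbf{x}$, and let $c_{2n}:=1+\frac{d}{2n}$. Let $\{P_{\boldsymbol{\alpha}}:\boldsymbol{\alpha}\in\mathbb{N}^d_{2n}\}$ be any basis of the space $\mathcal{H}[\mathbf{x}]_{2n}$ of degree-$2n$ forms which is orthonormal with respect to $\mu$, i.e. $\int P_{\boldsymbol{\alpha}}P_{\boldsymbol{\beta}}\,d\mu=\delta_{\boldsymbol{\alpha}\boldsymbol{\beta}}$ for all $\boldsymbol{\alpha},\boldsymbol{\beta}\in\mathbb{N}^d_{2n}$. Set $\mathbb{P}_{2n}(\mathbf{x}):=(P_{\boldsymbol{\alpha}}(\mathbf{x}))_{\boldsymbol{\alpha}\in\mathbb{N}^d_{2n}}$, let $\tilde{\mathbf{g}}$ be the coefficient vector of $g$ in this basis (so $g(\mathbf{x})=\langle\tilde{\mathbf{g}},\mathbb{P}_{2n}(\mathbf{x})\rangle$), let $\tilde{\boldsymbol{\mu}}^{(2n)}:=\int\mathbb{P}_{2n}(\mathbf{x})\,d\mu(\mathbf{x})$, and let $K^\mu_{2n}(\mathbf{x},\mathbf{y}):=\sum_{\boldsymbol{\alpha}\in\mathbb{N}^d_{2n}}P_{\boldsymbol{\alpha}}(\mathbf{x})P_{\boldsymbol{\alpha}}(\mathbf{y})$.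 Then \[\tilde{\mathbf{g}}=c_{2n}\,\tilde{\boldsymbol{\mu}}^{(2n)}=c_{2n}\int_{\mathbb{R}^d}\mathbb{P}_{2n}(\mathbf{x})\,\exp(-\langle\mathbb{P}_{2n}(\mathbf{x}),\tilde{\mathbf{g}}\rangle)\,d\mathbf{x},\] \[g(\mathbf{x})=c_{2n}\,\langle\mathbb{P}_{2n}(\mathbf{x}),\tilde{\boldsymbol{\mu}}^{(2n)}\rangle=c_{2n}\int K^\mu_{2n}(\mathbf{x},\mathbf{y})\,d\mu(\mathbf{y})\quad\text{for all }\mathbf{x}\in\mathbb{R}^d,\] \[\tilde{\boldsymbol{\mu}}^{(2n)}=\int_{\mathbb{R}^d}\mathbb{P}_{2n}(\mathbf{x})\,\exp\big(-c_{2n}\,\langle\mathbb{P}_{2n}(\mathbf{x}),\tilde{\boldsymbol{\mu}}^{(2n)}\rangle\big)\,d\mathbf{x}.\]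
   Context: $\mathbb{N}^d_{2n}=\{\boldsymbol{\alpha}\in\mathbb{N}^d:\sum_i\alpha_i=2n\}$. $\mathcal{H}[\mathbf{x}]_{2n}$ denotes the real vector space of homogeneous polynomials of degree $2n$ in $\mathbf{x}=(x_1,\dots,x_d)$, of dimension $\binom{d-1+2n}{2n}$. The degree-$2n$ moment matrix $\int \mathbf{v}_{2n}\mathbf{v}_{2n}^T d\mu$ (with $\mathbf{v}_{2n}(\mathbf{x})=(\mathbf{x}^{\boldsymbol{\alpha}})_{\boldsymbol{\alpha}\in\mathbb{N}^d_{2n}}$) is positive definite, so a $\mu$-orthonormal basis of $\mathcal{H}[\mathbf{x}]_{2n}$ exists. *)

(* Defs.v *)
From HB Require Import structures.
From mathcomp Require Import all_boot all_order all_algebra.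
From mathcomp Require Import all_classical all_reals all_analysis.
Set Implicit Arguments. Unset Strict Implicit. Unset Printing Implicit Defensive.
Import Order.TTheory GRing.Theory Num.Theory.
Local Open Scope ring_scope.

Section Defs.
Variable R : realType.

(* Exponent vectors alpha in N^d with |alpha| = k, encoded as finite
   functions 'I_d -> 'I_k.+1 (every coordinate of such alpha is <= k). *)
Definition expo (d k : nat) := {ffun 'I_d -> 'I_k.+1}.

Definition Nd (d k : nat) : {set expo d k} :=
  [set a : expo d k | \sum_(i < d) (a i : nat) == k]%N.

Definition monomial (d k : nat) (a : expo d k) (x : 'rV[R]_d) : R :=
  \prod_(i < d) x ord0 i ^+ a i.

Definition hform (d k : nat) (c : expo d k -> R) (x : 'rV[R]_d) : R :=
  \sum_(a in Nd d k) c a * monomial a x.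

(* Lebesgue integral over R^d, written as the iterated one-dimensional
   Lebesgue integral (equal to the d-dimensional Lebesgue integral for
   integrable functions, by Fubini). *)
Fixpoint intRd (d : nat) : ('rV[R]_d -> \bar R) -> \bar R :=
  match d with
  | 0 => fun f => f 0
  | d'.+1 => fun f =>
      (\int[@lebesgue_measure R]_t intRd (fun y : 'rV[R]_d' => f (row_mx (\row_(j < 1) t) y)))%E
  end.

Definition int_mu (d : nat) (g : 'rV[R]_d -> R) (f : 'rV[R]_d -> R) : \bar R :=
  intRd (fun x => (f x * expR (- g x))%:E).

End Defs.

(* Main.v *)
Require Import Defs.
From HB Require Import structures.
From mathcomp Require Import all_boot all_order all_algebra.
From mathcomp Require Import all_classical all_reals all_analysis.
From mathcomp Require Import measurable_realfun ring lra.
Import Order.TTheory GRing.Theory Num.Theory.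
Import numFieldNormedType.Exports.
Local Open Scope ring_scope.

(** By orthonormality the coefficients of [g] are [gt a = \int g P_a exp(-g)],
so everything reduces to [2n \int Q g exp(-g) = (2n + d) \int Q exp(-g)] for a
form [Q] of degree [2n].  Adding a multiple of [g] we may assume [Q >= 0].  Put
[s := l ^ 2n] with [l > 1]: convexity of the exponential gives
[(s - 1) g exp(-s g) <= exp(-g) - exp(-s g) <= (s - 1) g exp(-g)], and the
dilation [x := l x] turns the integrals against [exp(-s g)] into integrals
against [exp(-g)].  The two resulting inequalities are polynomial in [l];
dividing them by [l - 1] and letting [l] tend to [1] gives the identity.

The iterated integral is handled on the class of continuous functions dominated
by a multiple of [\prod_i 1 / (1 + x_i ^ 2)], where dominated convergence keeps
the inner integrals continuous. *)

Local Open Scope classical_set_scope.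

(** * The iterated integral on continuous functions with Cauchy-type decay *)

Section TameIntegral.
Variable R : realType.
Local Notation mu := (@lebesgue_measure R).

Definition slice (d : nat) (T : Type) (f : 'rV[R]_d.+1 -> T) (t : R)
    (y : 'rV[R]_d) : T :=
  f (row_mx (\row_(j < 1) t) y).

(** Real-valued counterpart of [intRd]. Each layer applies [fine], which sends infinite values to 0,
    so it is meaningful only where [EFin_RintRd] applies. *)
Fixpoint RintRd (d : nat) : ('rV[R]_d -> R) -> R :=
  match d with
  | 0 => fun f => f 0
  | d'.+1 => fun f => \int[mu]_t RintRd d' (slice d' R f t)
  end.

(** A product weight: fixing the first coordinate splits off one integrable factor, so slices
    inherit the domination. *)
Definition cauchy_weight (d : nat) (x : 'rV[R]_d) : R :=
  \prod_(i < d) (oneDsqr (x ord0 i))^-1.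

Definition cauchy_dominated (d : nat) (C : R) (f : 'rV[R]_d -> R) : Prop :=
  forall x, `|f x| <= C * cauchy_weight d x.

Definition tame (d : nat) (f : 'rV[R]_d -> R) : Prop :=
  continuous f /\ exists C, cauchy_dominated d C f.

Arguments slice {d T}.
Arguments RintRd {d}.
Arguments cauchy_weight {d}.
Arguments cauchy_dominated {d}.
Arguments tame {d}.

Lemma cauchy_weight_ge0 d (x : 'rV[R]_d) : 0 <= cauchy_weight x.
Proof. by apply: prodr_ge0 => i _; rewrite invr_ge0 (le_trans ler01). Qed.

Lemma row_mx_ord0 d t (y : 'rV[R]_d) :
  (row_mx (\row_(j < 1) t) y : 'rV[R]_d.+1) ord0 ord0 = t.
Proof.
transitivity (row_mx (\row_(j < 1) t) y ord0 (lshift d ord0)).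
  by congr (fun_of_matrix _ _ _); exact: val_inj.
by rewrite row_mxEl mxE.
Qed.

Lemma row_mx_lift d t (y : 'rV[R]_d) i :
  (row_mx (\row_(j < 1) t) y : 'rV[R]_d.+1) ord0 (lift ord0 i) = y ord0 i.
Proof.
transitivity (row_mx (\row_(j < 1) t) y ord0 (rshift 1 i)).
  by congr (fun_of_matrix _ _ _); exact: val_inj.
by rewrite row_mxEr.
Qed.

Lemma cauchy_weight_row_mx d t (y : 'rV[R]_d) :
  cauchy_weight (row_mx (\row_(j < 1) t) y : 'rV[R]_d.+1) =
  (oneDsqr t)^-1 * cauchy_weight y.
Proof.
rewrite /cauchy_weight big_ord_recl row_mx_ord0; congr (_ * _).
by apply: eq_bigr => i _; rewrite row_mx_lift.
Qed.

Lemma dominated_slice d C (f : 'rV[R]_d.+1 -> R) t :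
  cauchy_dominated C f -> cauchy_dominated (C * (oneDsqr t)^-1) (slice f t).
Proof. by move=> fC y; rewrite -mulrA -cauchy_weight_row_mx; exact: fC. Qed.

Lemma dominated_cst_ge0 d C (f : 'rV[R]_d -> R) : cauchy_dominated C f -> 0 <= C.
Proof.
move=> /(_ 0); have : 0 < cauchy_weight (0 : 'rV[R]_d).
  by apply: prodr_gt0 => i _; rewrite invr_gt0 (lt_le_trans ltr01).
by move=> w0 /(le_trans (normr_ge0 _)); rewrite pmulr_lge0.
Qed.

(** Weaker than [dominated_slice], but with a constant independent of [t], as needed when [t] runs
    along a sequence. *)
Lemma dominated_slice_le d C (f : 'rV[R]_d.+1 -> R) t :
  cauchy_dominated C f -> cauchy_dominated C (slice f t).
Proof.
move=> fC y; apply: (le_trans (dominated_slice d C f t fC y)).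
rewrite ler_wpM2r ?cauchy_weight_ge0// ler_piMr ?(dominated_cst_ge0 _ _ _ fC)//.
exact: oneDsqrV_le1.
Qed.

Lemma row_mx_affine d t (y : 'rV[R]_d) :
  row_mx (\row_(j < 1) t) y = row_mx 0 y + t *: row_mx (\row_(j < 1) 1) 0.
Proof.
rewrite scale_row_mx add_row_mx scaler0 addr0 add0r; congr row_mx.
by apply/rowP => j; rewrite !mxE mulr1.
Qed.

Lemma continuous_row_mxr d t : continuous (fun y : 'rV[R]_d =>
  row_mx (\row_(j < 1) t) y : 'rV[R]_d.+1).
Proof.
(* Dropping the ascription exposes the width [1 + d], which the block-matrix lemmas expect. *)
suff : continuous (fun y : 'rV[R]_d => row_mx (\row_(j < 1) t) y) by [].
move=> y; apply/(@cvgrPdist_lt _ _ _ (nbhs y)) => e e0.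
near=> z.
rewrite opp_row_mx add_row_mx subrr.
rewrite [ltLHS]/Num.norm/= mx_normrE.
apply: bigmax_lt => // -[i j] _ /=.
case: (split_ordP j) => k ->; first by rewrite row_mxEl mxE normr0.
rewrite row_mxEr.
apply: (@le_lt_trans _ _ `|y - z|); last by near: z; exact: cvgr_dist_lt.
rewrite [leRHS]/Num.norm/= mx_normrE.
by apply/bigmax_geP; right => /=; exists (i, k).
Unshelve. all: by end_near. Qed.

Lemma continuous_row_mxl d (y : 'rV[R]_d) : continuous (fun t : R =>
  row_mx (\row_(j < 1) t) y : 'rV[R]_d.+1).
Proof.
suff : continuous (fun t : R => row_mx (\row_(j < 1) t) y) by [].
move=> t; under eq_fun do rewrite row_mx_affine.
rewrite row_mx_affine.
apply: cvgD; first exact: cvg_cst.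
by apply: cvgZr_tmp; exact: cvg_id.
Qed.

Lemma continuous_slice d (f : 'rV[R]_d.+1 -> R) t :
  continuous f -> continuous (slice f t).
Proof.
move=> cf y; rewrite /slice.
apply: (@continuous_comp _ _ _ (fun y : 'rV[R]_d =>
  row_mx (\row_(j < 1) t) y : 'rV[R]_d.+1) f); last exact: cf.
exact: continuous_row_mxr.
Qed.

Lemma continuous_slice_var d (f : 'rV[R]_d.+1 -> R) y :
  continuous f -> continuous (fun t => slice f t y).
Proof.
move=> cf t; rewrite /slice.
apply: (@continuous_comp _ _ _ (fun t : R =>
  row_mx (\row_(j < 1) t) y : 'rV[R]_d.+1) f); last exact: cf.
exact: continuous_row_mxl.
Qed.

(** * One-dimensional Cauchy integrals and convergence of the iterated integral *)

Lemma integral_oneDsqrV : (\int[mu]_t ((oneDsqr t)^-1)%:E = (pi : R)%:E)%E.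
Proof.
(* The integrand is even, so the integral is twice its half-line value [pi / 2]. *)
rewrite ge0_symfun_integralT.
- rewrite -set_itvcy integral0y_oneDsqr -EFinM; congr EFin.
  by rewrite mulrCA divff ?mulr1.
- by move=> x; rewrite invr_ge0 (le_trans ler01).
- exact: continuous_oneDsqrV.
- by move=> x /=; rewrite /oneDsqr sqrrN.
Qed.

Lemma continuous_measurable_EFin (h : R -> R) : continuous h ->
  measurable_fun (setT : set (measurableTypeR R)) (EFin \o h).
Proof.
move=> ch; have mh : measurable_fun [set: R] h by exact: continuous_measurable_fun.
exact/measurable_EFinP.
Qed.

Lemma integrable_oneDsqrV : mu.-integrable setT (EFin \o (fun t => (oneDsqr t)^-1)).
Proof.
apply/integrableP; split.
  exact: continuous_measurable_EFin continuous_oneDsqrV.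
rewrite (_ : (\int[mu]_t _)%E = \int[mu]_t ((oneDsqr t)^-1)%:E)%E; last first.
  by apply: eq_integral => t _ /=; rewrite ger0_norm.
by rewrite integral_oneDsqrV ltry.
Qed.

Lemma integrable_oneDsqrVZ C :
  mu.-integrable setT (EFin \o (fun t => C * (oneDsqr t)^-1)).
Proof.
exact: (integrableZl _ C integrable_oneDsqrV).
Qed.

Lemma Rintegral_oneDsqrVZ C : \int[mu]_t (C * (oneDsqr t)^-1) = C * pi.
Proof.
rewrite RintegralZl//; last exact: integrable_oneDsqrV.
by rewrite /Rintegral integral_oneDsqrV.
Qed.

Lemma bounded_oneDsqrV_integrable C (h : R -> R) : continuous h ->
  (forall t, `|h t| <= C * (oneDsqr t)^-1) -> mu.-integrable setT (EFin \o h).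
Proof.
move=> ch hC; apply: le_integrable (integrable_oneDsqrVZ C) => //.
  exact: continuous_measurable_EFin.
by move=> t _ /=; rewrite lee_fin (le_trans (hC t))// ler_norm.
Qed.

(* The sequential statement in dimension [d] provides the continuity of the
   inner integral in dimension [d.+1], so both are proved together. *)
Lemma RintRd_bound_cvg d :
  (forall C (f : 'rV[R]_d -> R), continuous f -> cauchy_dominated C f ->
    `|RintRd f| <= C * pi ^+ d) /\
  (forall C (f_ : nat -> 'rV[R]_d -> R) (f : 'rV[R]_d -> R),
    (forall k, continuous (f_ k)) -> (forall k, cauchy_dominated C (f_ k)) ->
    continuous f -> cauchy_dominated C f ->
    (forall x, f_ k x @[k --> \oo] --> f x) ->
    RintRd (f_ k) @[k --> \oo] --> RintRd f).
Proof.
elim: d => [|d [IHb IHc]].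
  split=> [C f _ /(_ 0)|C f_ f _ _ _ _ ff]; last exact: ff.
  by rewrite /cauchy_weight big_ord0 expr0.
have bnd C (f : 'rV[R]_d.+1 -> R) : continuous f -> cauchy_dominated C f ->
    forall t, `|RintRd (slice f t)| <= C * pi ^+ d * (oneDsqr t)^-1.
  move=> cf fC t; rewrite mulrAC; apply: IHb; first exact: continuous_slice.
  exact: dominated_slice.
have cts C (f : 'rV[R]_d.+1 -> R) : continuous f -> cauchy_dominated C f ->
    continuous (fun t => RintRd (slice f t)).
  (* Sequential continuity: the slices at [u k] converge pointwise to the slice at [t] under one
     common bound, so the induction hypothesis [IHc] applies. *)
  move=> cf fC t; apply/(@cvg_nbhsP _ R^o) => u ut.
  apply: (IHc C).
  - by move=> k; exact: continuous_slice.
  - by move=> k; exact: dominated_slice_le.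
  - exact: continuous_slice.
  - exact: dominated_slice_le.
  - move=> x; have := continuous_slice_var d f x cf t.
    by move/(@cvg_nbhsP _ R^o); exact.
split=> [C f cf fC|C f_ f cf_ f_C cf fC ff] /=.
  have ih := bounded_oneDsqrV_integrable _ _ (cts C f cf fC) (bnd C f cf fC).
  apply: (le_trans (le_normr_Rintegral _ ih)) => //.
  rewrite exprSr mulrA -Rintegral_oneDsqrVZ; apply: le_Rintegral => //.
  - exact: (integrable_norm ih).
  - exact: integrable_oneDsqrVZ.
  - by move=> t _; exact: bnd.
apply: fine_cvg; rewrite fineK; last first.
  apply: integrable_fin_num => //.
  exact: bounded_oneDsqrV_integrable _ _ (cts C f cf fC) (bnd C f cf fC).
(* The majorant [C * pi ^+ d / (1 + t ^ 2)] is the bound [bnd], uniform in [k]. *)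
apply: (@dominated_cvg _ _ _ mu _ _
    (fun k t => (RintRd (slice (f_ k) t))%:E) _
    (EFin \o (fun t => C * pi ^+ d * (oneDsqr t)^-1))) => //=.
- by move=> k; apply: continuous_measurable_EFin; exact: (cts C).
- move=> t _; apply: cvg_EFin; first exact: nearW.
  apply: (IHc (C * (oneDsqr t)^-1)).
  + by move=> k; exact: continuous_slice.
  + by move=> k; exact: dominated_slice.
  + exact: continuous_slice.
  + exact: dominated_slice.
  + by move=> x; exact: ff.
- exact: integrable_oneDsqrVZ.
- by move=> k t _; rewrite lee_fin; exact: bnd.
Qed.

Lemma tame_slice d (f : 'rV[R]_d.+1 -> R) t : tame f -> tame (slice f t).
Proof.
move=> [cf [C fC]]; split; first exact: continuous_slice.
by exists (C * (oneDsqr t)^-1); exact: dominated_slice.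
Qed.


Lemma continuous_RintRd_slice d (f : 'rV[R]_d.+1 -> R) : tame f ->
  continuous (fun t => RintRd (slice f t)).
Proof.
move=> [cf [C fC]] t; apply/(@cvg_nbhsP _ R^o) => u ut.
apply: ((RintRd_bound_cvg d).2 C).
- by move=> k; exact: continuous_slice.
- by move=> k; exact: dominated_slice_le.
- exact: continuous_slice.
- exact: dominated_slice_le.
- move=> x; have := continuous_slice_var d f x cf t.
  by move/(@cvg_nbhsP _ R^o); exact.
Qed.

Lemma integrable_RintRd_slice d (f : 'rV[R]_d.+1 -> R) : tame f ->
  mu.-integrable setT (EFin \o (fun t => RintRd (slice f t))).
Proof.
move=> tf; have [cf [C fC]] := tf.
apply: (bounded_oneDsqrV_integrable (C * pi ^+ d)).
  exact: continuous_RintRd_slice.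
move=> t; rewrite mulrAC; apply: (RintRd_bound_cvg d).1.
  exact: continuous_slice.
exact: dominated_slice.
Qed.

(** Bridge to [intRd]: every layer of a tame function is integrable, so [fine] loses nothing. *)
Lemma EFin_RintRd d (f : 'rV[R]_d -> R) : tame f ->
  intRd (fun x => (f x)%:E) = (RintRd f)%:E.
Proof.
elim: d f => [//|d IH] f tf /=.
rewrite fineK; last first.
  by apply: integrable_fin_num => //; exact: integrable_RintRd_slice.
by apply: eq_integral => t _; exact: IH (tame_slice _ _ t tf).
Qed.

(** * Linearity, monotonicity and dilation *)

Lemma tameD d (f g : 'rV[R]_d -> R) :
  tame f -> tame g -> tame (fun x => f x + g x).
Proof.
move=> [cf [C fC]] [cg [D gD]]; split.
  by move=> x; exact: (cvgD (cf x) (cg x)).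
exists (C + D) => x; rewrite mulrDl (le_trans (ler_normD _ _))//.
exact: lerD.
Qed.

Lemma tameZ d (a : R) (f : 'rV[R]_d -> R) : tame f -> tame (fun x => a * f x).
Proof.
move=> [cf [C fC]]; split.
  by move=> x; exact: (cvgM (cvg_cst a) (cf x)).
by exists (`|a| * C) => x; rewrite normrM -mulrA ler_wpM2l.
Qed.

Lemma tame0 d : tame (fun _ : 'rV[R]_d => 0).
Proof.
split; first exact: cst_continuous.
by exists 0 => x; rewrite normr0 mul0r.
Qed.

Lemma tame_sum d (I : Type) (s : seq I) (P : pred I) (f : I -> 'rV[R]_d -> R) :
  (forall i, P i -> tame (f i)) -> tame (fun x => \sum_(i <- s | P i) f i x).
Proof.
move=> tf; elim: s => [|i s IH].
  by under eq_fun do rewrite big_nil; exact: tame0.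
case Pi: (P i); last by under eq_fun do rewrite big_cons Pi.
by under eq_fun do rewrite big_cons Pi; apply: tameD => //; exact: tf.
Qed.

(** For [1 <= l] the dilation can only decrease the Cauchy weight, so the same constant [C]
    works. *)
Lemma tame_scale d (l : R) (f : 'rV[R]_d -> R) : 1 <= l -> tame f ->
  tame (fun x => f (l *: x)).
Proof.
move=> l1 [cf [C fC]]; split.
  move=> x; apply: (@continuous_comp _ _ _ (fun x : 'rV[R]_d => l *: x) f).
    exact: scaler_continuous.
  exact: cf.
exists C => x; apply: (le_trans (fC _)).
rewrite ler_wpM2l ?(dominated_cst_ge0 _ _ _ fC)//.
apply: ler_prod => i _; rewrite mxE invr_ge0 (le_trans ler01 (oneDsqr_ge1 _))/=.
rewrite lef_pV2 ?posrE ?(lt_le_trans ltr01 (oneDsqr_ge1 _))//.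
by rewrite /oneDsqr lerD2l exprMn ler_peMl ?sqr_ge0// exprn_ege1.
Qed.

Lemma RintRdD d (f g : 'rV[R]_d -> R) : tame f -> tame g ->
  RintRd (fun x => f x + g x) = RintRd f + RintRd g.
Proof.
elim: d f g => [//|d IH] f g tf tg /=.
rewrite -RintegralD//; [|exact: integrable_RintRd_slice..].
by apply: eq_Rintegral => t _; rewrite -IH//; exact: tame_slice.
Qed.

Lemma RintRdZ d (a : R) (f : 'rV[R]_d -> R) : tame f ->
  RintRd (fun x => a * f x) = a * RintRd f.
Proof.
elim: d f => [//|d IH] f tf /=.
rewrite -RintegralZl//; last exact: integrable_RintRd_slice.
by apply: eq_Rintegral => t _; rewrite -IH//; exact: tame_slice.
Qed.

Lemma RintRd_sum d (I : Type) (s : seq I) (P : pred I) (f : I -> 'rV[R]_d -> R) :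
  (forall i, P i -> tame (f i)) ->
  RintRd (fun x => \sum_(i <- s | P i) f i x) = \sum_(i <- s | P i) RintRd (f i).
Proof.
move=> tf; elim: s => [|i s IH].
  rewrite big_nil; under [X in RintRd X]eq_fun do rewrite big_nil.
  by have := RintRdZ d 0 _ (tame0 d); rewrite !mul0r.
rewrite big_cons; case Pi: (P i); last first.
  by under [X in RintRd X]eq_fun do rewrite big_cons Pi.
under [X in RintRd X]eq_fun do rewrite big_cons Pi.
by rewrite RintRdD ?IH//; [exact: tf | exact: tame_sum].
Qed.

Lemma RintRd_ge0 d (f : 'rV[R]_d -> R) : (forall x, 0 <= f x) -> 0 <= RintRd f.
Proof.
elim: d f => [|d IH] f f0 /=; first exact: f0.
by apply: Rintegral_ge0 => t _; apply: IH => y; exact: f0.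
Qed.

Lemma le_RintRd d (f g : 'rV[R]_d -> R) : tame f -> tame g ->
  (forall x, f x <= g x) -> RintRd f <= RintRd g.
Proof.
elim: d f g => [|d IH] f g tf tg fg /=; first exact: fg.
apply: le_Rintegral => //; [exact: integrable_RintRd_slice..|].
by move=> t _; apply: IH => [||y]; [exact: tame_slice..|exact: fg].
Qed.

Lemma Rintegral_dilation (l : R) (h : R -> R) : 0 < l -> continuous h ->
  (forall t, 0 <= h t) -> \int[mu]_t h t = \int[mu]_t (l * h (l * t)).
Proof.
move=> l0 ch h0.
pose F : R -> R := fun t => l * t.
have dF (t : R) : is_derive t (1 : R) F l.
  rewrite -[X in is_derive _ _ _ X](mulr1 l).
  exact: (@is_deriveZ _ _ _ id l t 1 1).
have F'E : derive1 F = cst l.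
  by apply/funext => t; rewrite derive1E derive_val.
rewrite /Rintegral (@increasing_ge0_integration_by_substitutionT _ F) //.
- by congr fine; apply: eq_integral => t _; rewrite F'E /= mulrC.
- by move=> x y xy; rewrite /F ltr_pM2l.
- by rewrite F'E => x; exact: cvg_cst.
- by rewrite F'E; exact: is_cvg_cst.
- by rewrite F'E; exact: is_cvg_cst.
- by apply: gt0_cvgMrNy => //; exact: cvg_id.
- by apply: gt0_cvgMry => //; exact: cvg_id.
Qed.

(** One-dimensional substitution in each coordinate, contributing one factor [l] each. *)
Lemma RintRd_dilation d (l : R) (f : 'rV[R]_d -> R) : 1 <= l -> tame f ->
  (forall x, 0 <= f x) -> RintRd f = l ^+ d * RintRd (fun x => f (l *: x)).
Proof.
move=> l1; elim: d f => [|d IH] f tf f0 /=.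
  by rewrite expr0 mul1r scaler0.
rewrite (Rintegral_dilation l) ?(lt_le_trans ltr01)//; first last.
- by move=> t; apply: RintRd_ge0 => y; exact: f0.
- exact: continuous_RintRd_slice.
rewrite -RintegralZl//; last first.
  exact: (integrable_RintRd_slice _ _ (tame_scale _ _ _ l1 tf)).
apply: eq_Rintegral => t _.
rewrite IH; [|exact: tame_slice|by move=> y; exact: f0].
rewrite mulrA -exprS; congr (_ * RintRd _).
(* Dilating the slice at [l * t] is the same as slicing the dilated function at [t]. *)
apply/funext => y; rewrite /slice; congr f.
have -> : \row_(j < 1) (l * t) = l *: \row_(j < 1) t.
  by apply/rowP => j; rewrite !mxE.
by rewrite -scale_row_mx.
Qed.

End TameIntegral.

Arguments RintRd {R d}.
Arguments cauchy_weight {R d}.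
Arguments tame {R d}.

(** * Homogeneity, continuity and growth of forms *)

Section Forms.
Variable R : realType.

Lemma hformD d k (c e : expo d k -> R) x :
  hform (fun a => c a + e a) x = hform c x + hform e x.
Proof. by rewrite /hform -big_split; apply: eq_bigr => a _; rewrite mulrDl. Qed.

Lemma hformZ d k r (c : expo d k -> R) x :
  hform (fun a => r * c a) x = r * hform c x.
Proof. by rewrite /hform mulr_sumr; apply: eq_bigr => a _; rewrite mulrA. Qed.

Lemma monomial_scale d k (a : expo d k) l (x : 'rV[R]_d) : a \in Nd d k ->
  monomial a (l *: x) = l ^+ k * monomial a x.
Proof.
rewrite inE => /eqP ak; rewrite /monomial.
under eq_bigr => i _ do rewrite mxE exprMn.
by rewrite big_split /= -[X in l ^+ X]ak -expr_sum.
Qed.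

Lemma hform_scale d k (c : expo d k -> R) l x :
  hform c (l *: x) = l ^+ k * hform c x.
Proof.
rewrite /hform mulr_sumr; apply: eq_bigr => a aN.
by rewrite monomial_scale// mulrCA.
Qed.

Lemma coord_le_norm d (x : 'rV[R]_d) i : `|x ord0 i| <= `|x|.
Proof.
rewrite [leRHS]/Num.norm/= mx_normrE.
by apply/bigmax_geP; right => /=; exists (ord0, i).
Qed.

Lemma norm_monomial_le d k (a : expo d k) (x : 'rV[R]_d) : a \in Nd d k ->
  `|monomial a x| <= `|x| ^+ k.
Proof.
rewrite inE => /eqP ak; rewrite /monomial normr_prod -[X in _ ^+ X]ak expr_sum.
apply: ler_prod => i _; rewrite normr_ge0 normrX.
by rewrite lerXn2r ?nnegrE ?normr_ge0// coord_le_norm.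
Qed.

Lemma norm_hform_le d k (c : expo d k -> R) :
  exists2 M, 0 <= M & forall x, `|hform c x| <= M * `|x| ^+ k.
Proof.
exists (\sum_(a in Nd d k) `|c a|); first by apply: sumr_ge0 => a _.
move=> x; rewrite /hform (le_trans (ler_norm_sum _ _ _))// mulr_suml.
apply: ler_sum => a aN; rewrite normrM ler_wpM2l//.
exact: norm_monomial_le.
Qed.

Lemma continuous_monomial d k (a : expo d k) :
  continuous (monomial a : 'rV[R]_d -> R).
Proof.
rewrite /monomial; elim: (index_enum _) => [|i s IH].
  by under eq_fun do rewrite big_nil; exact: cst_continuous.
under eq_fun do rewrite big_cons.
move=> x; apply: (@continuousM _ _ (fun x : 'rV[R]_d => x ord0 i ^+ a i)).
  apply: (@continuous_comp _ _ _ (fun x : 'rV[R]_d => x ord0 i)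
    (fun r : R => r ^+ a i)).
    exact: coord_continuous.
  exact: exprn_continuous.
exact: IH.
Qed.

Lemma continuous_hform d k (c : expo d k -> R) : continuous (hform c).
Proof.
rewrite /hform; elim: (index_enum _) => [|a s IH].
  by under eq_fun do rewrite big_nil; exact: cst_continuous.
case aN : (a \in Nd d k); last by under eq_fun do rewrite big_cons aN.
under eq_fun do rewrite big_cons aN.
move=> x; apply: (@continuousD _ _ _ (fun x => c a * monomial a x)).
  apply: (@continuousM _ _ (cst (c a))); first exact: cst_continuous.
  exact: continuous_monomial.
exact: IH.
Qed.

(** [m] is the minimum of the form on the compact unit sphere, positive since 0 is the only zero;
    homogeneity extends the bound to all [x]. *)
Lemma pos_form_lower_bound d k (g : expo d k -> R) : (0 < k)%N ->
  (forall x, 0 <= hform g x) -> (forall x, hform g x = 0 -> x = 0) ->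
  exists2 m, 0 < m & forall x, m * `|x| ^+ k <= hform g x.
Proof.
move=> k0 g0 gz.
pose S : set 'rV[R]_d := [set x | `|x| = 1].
have cS : compact S.
  apply: bounded_closed_compact.
    exists 1; split; first exact: num_real.
    by move=> M M1 x /= ->; exact: ltW.
  rewrite (_ : S = (fun x : 'rV[R]_d => `|x|) @^-1` [set 1])//.
  apply: preimage_closed; first by move=> x _; exact: norm_continuous.
  exact: closed_eq.
have [m m0 mS] : exists2 m, 0 < m & forall x, S x -> m <= hform g x.
  (* The sphere is empty in dimension 0, where any positive constant serves. *)
  have [S0|nS] := pselect (S !=set0); last first.
    by exists 1 => // x Sx; exfalso; apply: nS; exists x.
  have cg : {within S, continuous (hform g)}.
    exact/continuous_subspaceT/continuous_hform.
  have [x0 x0S gmin] := compact_EVT_min S0 cS cg.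
  exists (hform g x0).
    rewrite lt_neqAle g0 andbT eq_sym; apply/eqP => /gz x00.
    by move: x0S; rewrite inE x00 /S /= normr0 => /esym/eqP; rewrite oner_eq0.
  by move=> x Sx; apply: gmin; rewrite inE.
exists m => // x; have [->|x0] := eqVneq x 0.
  by rewrite normr0 expr0n gtn_eqF// mulr0.
have nx : `|x| != 0 by rewrite normr_eq0.
rewrite -[in leRHS](scalerKV nx x) hform_scale mulrC ler_wpM2l ?exprn_ge0//.
by apply: mS; rewrite /S /= normrZ normfV normr_id mulVf.
Qed.

(** For [N > 0], [1 + u <= N * (1 + u / N) <= N * expR (u / N)]; raise this to the power [N]. *)
Lemma le_expn_expR N (u : R) : 0 <= u ->
  (1 + u) ^+ N * expR (- u) <= (N ^ N)%:R.
Proof.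
move=> u0; rewrite expRN ler_pdivrMr ?expR_gt0//.
case: N => [|N]; first by rewrite expr0 expn0 mul1r -[leLHS]expR0 ler_expR.
have N0 : N.+1%:R != 0 :> R by rewrite pnatr_eq0.
rewrite -[in leRHS](divfK N0 u) expRM_natr natrX -exprMn.
rewrite lerXn2r ?nnegrE ?mulr_ge0 ?expR_ge0 ?addr_ge0//.
apply: (@le_trans _ _ (N.+1%:R * (1 + u / N.+1%:R))); last first.
  by rewrite ler_wpM2l// expR_ge1Dx.
by rewrite mulrDr mulr1 mulrC divfK// lerD2r ler1n.
Qed.

Lemma cauchy_weightV d (x : 'rV[R]_d) :
  (cauchy_weight x)^-1 = \prod_(i < d) oneDsqr (x ord0 i).
Proof. by rewrite /cauchy_weight prodfV invrK. Qed.

(** * Tameness of forms multiplied by [expR (- g)] *)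

Section PositiveForm.
Variables (d k : nat) (g : expo d k -> R).
Hypothesis k2 : (2 <= k)%N.
Hypothesis g0 : forall x, 0 <= hform g x.
Hypothesis gz : forall x, hform g x = 0 -> x = 0.

(** Both forms are compared with the [k]-th power of the norm. Besides the growth bound, this gives
    an [M] for which [c + M g] is nonnegative. *)
Lemma hform_le_pos (c : expo d k -> R) :
  exists2 M, 0 <= M & forall x, `|hform c x| <= M * hform g x.
Proof.
have [m m0 mg] := pos_form_lower_bound d k g (ltnW k2) g0 gz.
have [M M0 Mc] := norm_hform_le d k c.
exists (M / m); first by rewrite divr_ge0// ltW.
move=> x; apply: (le_trans (Mc x)).
by rewrite -mulrA ler_wpM2l// mulrC ler_pdivlMr// mulrC.
Qed.

(** Since [k >= 2], each factor satisfies [1 + x_i ^ 2 <= 2 + |x| ^ k <= 2 + g / m], which is at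
    most [(2 + 1 / m) * (1 + g)]. *)
Lemma cauchy_weightV_le :
  exists2 C, 0 <= C & forall x : 'rV[R]_d,
    (cauchy_weight x)^-1 <= (C * (1 + hform g x)) ^+ d.
Proof.
have [m m0 mg] := pos_form_lower_bound d k g (ltnW k2) g0 gz.
exists (2 + m^-1); first by rewrite addr_ge0// invr_ge0 ltW.
move=> x; rewrite cauchy_weightV.
rewrite -[X in _ ^+ X](card_ord d) -prodr_const.
apply: ler_prod => i _; rewrite (le_trans ler01 (oneDsqr_ge1 _))/=.
have xk : x ord0 i ^+ 2 <= 1 + `|x| ^+ k.
  have xi : x ord0 i ^+ 2 <= `|x| ^+ 2.
    by rewrite -[leLHS]ger0_norm ?sqr_ge0// normrX lerXn2r ?nnegrE// coord_le_norm.
  apply: (le_trans xi); have [x1|/ltW x1] := leP `|x| 1.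
    by rewrite (@le_trans _ _ 1)// ?exprn_ile1// lerDl exprn_ge0.
  by rewrite (@le_trans _ _ (`|x| ^+ k))// ?ler_weXn2l// lerDr.
have xg : `|x| ^+ k <= m^-1 * hform g x.
  by rewrite mulrC ler_pdivlMr// mulrC.
have mV : 0 <= m^-1 by rewrite invr_ge0 ltW.
have gx := g0 x.
rewrite /oneDsqr; nra.
Qed.

Lemma tame_mul_expR N M (f : 'rV[R]_d -> R) : continuous f ->
  (forall x, `|f x| <= M * (1 + hform g x) ^+ N) ->
  tame (fun x => f x * expR (- hform g x)).
Proof.
move=> cf fM; split.
  move=> x; apply: (@continuousM _ _ f); first exact: cf.
  apply: (@continuous_comp _ _ _ (fun x => - hform g x) expR).
    by apply: continuousN; exact: continuous_hform.
  exact: continuous_expR.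
have [C C0 wC] := cauchy_weightV_le.
(* The exponential absorbs [N + d] powers of [1 + g]: [N] from the growth of [f] and [d] from the
   inverse weight. *)
exists (`|M| * C ^+ d * ((N + d) ^ (N + d))%:R) => x.
have w0 : 0 < cauchy_weight x.
  by apply: prodr_gt0 => i _; rewrite invr_gt0 (lt_le_trans ltr01).
rewrite -ler_pdivrMr// normrM (ger0_norm (expR_ge0 _)).
have gx := g0 x.
apply: (@le_trans _ _ (`|M| * (1 + hform g x) ^+ N * expR (- hform g x) *
    (C * (1 + hform g x)) ^+ d)).
  apply: ler_pM => //; first by rewrite invr_ge0 ltW.
  rewrite ler_wpM2r ?expR_ge0// (le_trans (fM x))// ler_wpM2r// ?ler_norm//.
  by rewrite exprn_ge0// addr_ge0.
rewrite exprMn [leLHS](_ : _ = `|M| * C ^+ d *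
    ((1 + hform g x) ^+ (N + d) * expR (- hform g x))); last first.
  by rewrite exprD; ring.
by rewrite ler_wpM2l ?mulr_ge0// ?exprn_ge0// le_expn_expR.
Qed.

Lemma tame_hform (c : expo d k -> R) :
  tame (fun x => hform c x * expR (- hform g x)).
Proof.
have [M M0 cM] := hform_le_pos c.
apply: (tame_mul_expR 1 M); first exact: continuous_hform.
by move=> x; rewrite (le_trans (cM x))// ler_wpM2l// expr1 lerDr.
Qed.

Lemma tame_hformM (c e : expo d k -> R) :
  tame (fun x => hform c x * hform e x * expR (- hform g x)).
Proof.
have [M M0 cM] := hform_le_pos c; have [L L0 eL] := hform_le_pos e.
apply: (tame_mul_expR 2 (M * L)).
  by move=> x; apply: (@continuousM _ _ (hform c)); exact: continuous_hform.
move=> x; rewrite normrM expr2 mulrACA ler_pM//.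
- by rewrite (le_trans (cM x))// ler_wpM2l// lerDr.
- by rewrite (le_trans (eL x))// ler_wpM2l// lerDr.
Qed.

End PositiveForm.

(* Convexity of [expR] compares the difference quotient in [s] of
   [expR (- s * u)] with its derivatives at both ends. *)
Lemma expR_convex_bounds (s u : R) :
  (s - 1) * u * expR (- (s * u)) <= expR (- u) - expR (- (s * u)) <=
  (s - 1) * u * expR (- u).
Proof.
(* Both bounds reduce to [1 + v <= expR v], with [v = (s - 1) * u] for the lower and its opposite
   for the upper. *)
have e1 : expR (- u) = expR (- (s * u)) * expR ((s - 1) * u).
  by rewrite -expRD; congr expR; ring.
have e2 : expR (- (s * u)) = expR (- u) * expR (- ((s - 1) * u)).
  by rewrite -expRD; congr expR; ring.
apply/andP; split.
  rewrite e1; have := expR_ge1Dx ((s - 1) * u).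
  by have := expR_gt0 (- (s * u)); nra.
rewrite e2; have := expR_ge1Dx (- ((s - 1) * u)).
by have := expR_gt0 (- u); nra.
Qed.

(** Continuity of polynomials lets inequalities with [l - 1] divided out pass to [l = 1], so no
    derivative is taken. *)
Lemma horner_le_right_limit (p q : {poly R}) (a : R) :
  (forall l, a < l -> p.[l] <= q.[l]) -> p.[a] <= q.[a].
Proof.
move=> pq; apply: (@ler_cvg_to _ (at_right a) _ _ (horner p) (horner q)).
- by apply: cvg_at_right_filter; exact: continuous_horner.
- by apply: cvg_at_right_filter; exact: continuous_horner.
- by near=> l; apply: pq; near: l; exact: nbhs_right_gt.
Unshelve. all: by end_near. Qed.

(** * The moment identity obtained by dilation *)

Section EulerIdentity.
Variables (d k : nat) (g : expo d k -> R).
Hypothesis k2 : (2 <= k)%N.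
Hypothesis g0 : forall x, 0 <= hform g x.
Hypothesis gz : forall x, hform g x = 0 -> x = 0.

Let intA (c : expo d k -> R) := RintRd (fun x => hform c x * expR (- hform g x)).
Let intB (c : expo d k -> R) :=
  RintRd (fun x => hform c x * hform g x * expR (- hform g x)).

Lemma dilation_bounds (c : expo d k -> R) (l : R) : (forall x, 0 <= hform c x) ->
  1 <= l ->
  (l ^+ k - 1) * intB c <= l ^+ k * (l ^+ (k + d) - 1) * intA c /\
  (l ^+ (k + d) - 1) * intA c <= l ^+ (k + d) * (l ^+ k - 1) * intB c.
Proof.
move=> c0 l1; have l0 : 0 < l by rewrite (lt_le_trans ltr01).
set s := l ^+ k; have s0 : 0 < s by rewrite exprn_gt0.
have tA := tame_hform d k g k2 g0 gz c.
have tB := tame_hformM d k g k2 g0 gz c g.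
have tA' := tame_scale R _ l _ l1 tA; have tB' := tame_scale R _ l _ l1 tB.
have eA := RintRd_dilation R d l _ l1 tA.
have eB := RintRd_dilation R d l _ l1 tB.
rewrite -/(intA c) in eA; rewrite -/(intB c) in eB.
have {}eA := eA (fun x => mulr_ge0 (c0 x) (expR_ge0 _)).
have {}eB := eB (fun x => mulr_ge0 (mulr_ge0 (c0 x) (g0 x)) (expR_ge0 _)).
set A' := RintRd _ in eA; set B' := RintRd _ in eB.
(* By homogeneity the integrands of [A'] and [B'] are [s * c * expR (- s g)] and
   [s ^ 2 * c * g * expR (- s g)]. Multiplying the convexity bounds by [s ^ 2 * c] therefore avoids
   any division. *)
have up : (s - 1) * B' + s * A' <= s ^+ 2 * intA c.
  rewrite -!RintRdZ// -RintRdD//; [|exact: tameZ..].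
  apply: le_RintRd; [by apply: tameD; exact: tameZ|exact: tameZ|].
  move=> x; rewrite !hform_scale -/s.
  have /andP[] := expR_convex_bounds s (hform g x).
  set E := expR _; set F := expR _ => H _.
  have := ler_wpM2l (mulr_ge0 (sqr_ge0 s) (c0 x)) H.
  rewrite -subr_ge0 -[in X in _ -> X]subr_ge0 => /le_trans; apply.
  by rewrite le_eqVlt; apply/orP; left; apply/eqP; ring.
have lo : s ^+ 2 * intA c <= s * A' + s ^+ 2 * (s - 1) * intB c.
  rewrite -!RintRdZ// -RintRdD//; [|exact: tameZ..].
  apply: le_RintRd; [exact: tameZ|by apply: tameD; exact: tameZ|].
  move=> x; rewrite !hform_scale -/s.
  have /andP[] := expR_convex_bounds s (hform g x).
  set E := expR _; set F := expR _ => _ H.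
  have := ler_wpM2l (mulr_ge0 (sqr_ge0 s) (c0 x)) H.
  rewrite -subr_ge0 -[in X in _ -> X]subr_ge0 => /le_trans; apply.
  by rewrite le_eqVlt; apply/orP; left; apply/eqP; ring.
have ld : 0 < l ^+ d by rewrite exprn_gt0.
rewrite exprD -/s; split.
  (* The factor [l ^+ d] turns [A'] and [B'] back into [intA c] and [intB c]. *)
  have := ler_wpM2l (ltW ld) up; rewrite mulrDr !(mulrCA (l ^+ d)) -eA -eB.
  have -> : s * (s * l ^+ d - 1) * intA c = s ^+ 2 * (l ^+ d * intA c) - s * intA c.
    by ring.
  by rewrite lerBrDr.
(* Here [lo] carries a surplus factor [s], so the goal is multiplied by [s] first. *)
rewrite -(ler_pM2l s0).
have := ler_wpM2l (ltW ld) lo; rewrite mulrDr (mulrCA _ s) -eA.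
have -> : s * ((s * l ^+ d - 1) * intA c) = l ^+ d * (s ^+ 2 * intA c) - s * intA c.
  by ring.
rewrite lerBlDl => /le_trans; apply.
by rewrite lerD2l le_eqVlt; apply/orP; left; apply/eqP; ring.
Qed.

Lemma moment_identity_ge0 (c : expo d k -> R) : (forall x, 0 <= hform c x) ->
  k%:R * intB c = (k + d)%:R * intA c.
Proof.
move=> c0.
(* [S N] is the quotient of [l ^ N - 1] by [l - 1]; its value [N] at 1 produces the coefficients [k]
   and [k + d]. *)
pose S N : {poly R} := \sum_(i < N) 'X^i.
have SE N (l : R) : (l - 1) * (S N).[l] = l ^+ N - 1.
  rewrite subrX1 /S horner_sum; congr (_ * _).
  by apply: eq_bigr => i _; rewrite hornerXn.
have S1 N : (S N).[1] = N%:R.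
  rewrite /S horner_sum; under eq_bigr => i _ do rewrite hornerXn expr1n.
  by rewrite sumr_const card_ord.
have key l : 1 < l -> (S k * (intB c)%:P).[l] <= ('X^k * S (k + d)%N * (intA c)%:P).[l]
  /\ (S (k + d)%N * (intA c)%:P).[l] <= ('X^(k + d) * S k * (intB c)%:P).[l].
  move=> l1; have [] := dilation_bounds c l c0 (ltW l1).
  rewrite -!SE !hornerM !hornerC !hornerXn.
  have l0 : 0 < l - 1 by rewrite subr_gt0.
  by rewrite -!mulrA ![l ^+ _ * ((l - 1) * _)]mulrCA !ler_pM2l.
apply/eqP; rewrite eq_le; apply/andP; split.
  have := horner_le_right_limit _ _ 1 (fun l l1 => (key l l1).1).
  by rewrite !hornerM !hornerC hornerXn expr1n mul1r !S1.
have := horner_le_right_limit _ _ 1 (fun l l1 => (key l l1).2).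
by rewrite !hornerM !hornerC hornerXn expr1n mul1r !S1.
Qed.

(** Both sides are linear in [c]: apply the nonnegative case to [c + M g] and to [g], then
    cancel. *)
Lemma moment_identity (c : expo d k -> R) :
  k%:R * intB c = (k + d)%:R * intA c.
Proof.
have [M M0 cM] := hform_le_pos d k g k2 g0 gz c.
have tA e := tame_hform d k g k2 g0 gz e.
have tB e := tame_hformM d k g k2 g0 gz e g.
have intAD e : intA (fun a => e a + M * g a) = intA e + M * intA g.
  rewrite /intA -RintRdZ// -RintRdD//; last exact: tameZ.
  congr RintRd; apply/funext => x; rewrite hformD hformZ; ring.
have intBD e : intB (fun a => e a + M * g a) = intB e + M * intB g.
  rewrite /intB -RintRdZ// -RintRdD//; last exact: tameZ.
  congr RintRd; apply/funext => x; rewrite hformD hformZ; ring.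
have := moment_identity_ge0 (fun a => c a + M * g a).
rewrite intAD intBD => H.
have {}H : k%:R * (intB c + M * intB g) = (k + d)%:R * (intA c + M * intA g).
  apply: H => x; rewrite hformD hformZ -lerBlDr sub0r.
  by have := cM x; rewrite ler_norml => /andP[].
have Hg := moment_identity_ge0 g g0.
move: H; rewrite !mulrDr !(mulrCA _ M) Hg => /addIr; exact.
Qed.

End EulerIdentity.
End Forms.

(* Coefficients of [g] in the orthonormal basis *)
Local Close Scope classical_set_scope.

Theorem theorem2p2 (R : realType) (d n : nat) (hd : (1 <= d)%N) (hn : (1 <= n)%N)
  (gc : expo d (2 * n) -> R)
  (hg_nonneg : forall x : 'rV[R]_d, 0 <= hform gc x)
  (hg_zero : forall x : 'rV[R]_d, hform gc x = 0 -> x = 0)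
  (P : expo d (2 * n) -> expo d (2 * n) -> R)
  (* P a is the coefficient vector of the basis hform P_a *)
  (hP_basis : forall c : expo d (2 * n) -> R, exists t : expo d (2 * n) -> R,
      forall x : 'rV[R]_d,
        hform c x = \sum_(a in Nd d (2 * n)) t a * hform (P a) x)
  (hP_orth : forall a b, a \in Nd d (2 * n) -> b \in Nd d (2 * n) ->
      int_mu (hform gc) (fun x => hform (P a) x * hform (P b) x)
      = ((a == b)%:R)%:E)
  (gt : expo d (2 * n) -> R)
  (hgt : forall x : 'rV[R]_d,
      hform gc x = \sum_(a in Nd d (2 * n)) gt a * hform (P a) x) :
  let c2n : R := 1 + d%:R / (2 * n)%:R in
  let mut : expo d (2 * n) -> \bar R := fun a => int_mu (hform gc) (hform (P a)) in
  (forall a, a \in Nd d (2 * n) ->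
     (gt a)%:E = (c2n%:E * mut a)%E /\
     (gt a)%:E = (c2n%:E * intRd (fun x : 'rV[R]_d =>
         (hform (P a) x *
          expR (- \sum_(b in Nd d (2 * n)) hform (P b) x * gt b))%:E))%E) /\
  (forall x : 'rV[R]_d,
     (hform gc x)%:E = (c2n%:E * \sum_(a in Nd d (2 * n)) (hform (P a) x)%:E * mut a)%E /\
     (hform gc x)%:E = (c2n%:E * int_mu (hform gc) (fun y =>
         (\sum_(a in Nd d (2 * n)) hform (P a) x * hform (P a) y)%R))%E) /\
  (forall a, a \in Nd d (2 * n) ->
     mut a = intRd (fun x : 'rV[R]_d =>
         (hform (P a) x *
          expR (- (c2n * \sum_(b in Nd d (2 * n)) hform (P b) x * fine (mut b))))%:E)).
Proof.
move=> c2n mut.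
have k2 : (2 <= 2 * n)%N by rewrite -{1}[2%N]muln1 leq_mul2l.
have kn0 : (2 * n)%:R != 0 :> R by rewrite pnatr_eq0 -lt0n (leq_trans _ k2).
have tA := tame_hform R d _ gc k2 hg_nonneg hg_zero.
have tB := tame_hformM R d _ gc k2 hg_nonneg hg_zero.
pose A a := RintRd (fun x => hform (P a) x * expR (- hform gc x)).
have mutE a : mut a = (A a)%:E by rewrite /mut /int_mu EFin_RintRd.
have orth a b : a \in Nd d (2 * n) -> b \in Nd d (2 * n) ->
    RintRd (fun x => hform (P a) x * hform (P b) x * expR (- hform gc x)) =
    (a == b)%:R.
  by move=> aN bN; apply: EFin_inj; rewrite -hP_orth// /int_mu EFin_RintRd.
have gtE a : a \in Nd d (2 * n) -> gt a = c2n * A a.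
  move=> aN.
  have gtB : RintRd (fun x => hform (P a) x * hform gc x * expR (- hform gc x))
      = gt a.
    (* Expanding [g] in the basis leaves, by orthonormality, only the term [b = a]. *)
    transitivity (RintRd (fun x => \sum_(b in Nd d (2 * n))
        gt b * (hform (P a) x * hform (P b) x * expR (- hform gc x)))).
      congr RintRd; apply/funext => x.
      rewrite [X in _ * X * _]hgt mulr_sumr mulr_suml.
      by apply: eq_bigr => b _; ring.
    rewrite RintRd_sum; last by move=> b _; apply: tameZ; exact: tB.
    rewrite (bigD1 a)//= RintRdZ; last exact: tB.
    rewrite orth// eqxx mulr1 big1 ?addr0// => b /andP[bN ba].
    by rewrite RintRdZ ?orth// 1?eq_sym ?(negbTE ba) ?mulr0//; exact: tB.
  have := moment_identity R d _ gc k2 hg_nonneg hg_zero (P a).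
  rewrite gtB -/(A a) => H; apply: (mulfI kn0).
  (* [c2n] is the ratio [(2n + d) / 2n] of the coefficients in the moment identity. *)
  by rewrite H /c2n natrD mulrA mulrDr mulr1 mulrCA divff ?mulr1.
have gE x : hform gc x = c2n * \sum_(b in Nd d (2 * n)) hform (P b) x * A b.
  rewrite hgt mulr_sumr; apply: eq_bigr => b bN.
  by rewrite gtE// mulrAC mulrA.
split; [|split].
- move=> a aN; rewrite mutE -EFinM -gtE//; split => //.
  under [X in intRd X]eq_fun => x.
    under eq_bigr => b _ do rewrite mulrC.
    rewrite -hgt; over.
  by rewrite EFin_RintRd//= -EFinM -gtE.
- move=> x; rewrite gE; split.
    rewrite EFinM -sumEFin; congr (_ * _)%E.
    by apply: eq_bigr => b _; rewrite mutE -EFinM.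
  rewrite /int_mu EFinM; congr (_ * _)%E.
  (* The finite kernel sum is exchanged with the integral, each term being tame in [y]. *)
  transitivity (RintRd (fun y => \sum_(b in Nd d (2 * n))
      hform (P b) x * (hform (P b) y * expR (- hform gc y))))%:E.
    rewrite RintRd_sum; last by move=> b _; exact: tameZ.
    by congr EFin; apply: eq_bigr => b _; rewrite RintRdZ.
  rewrite -EFin_RintRd; last by apply: tame_sum => b _; exact: tameZ.
  congr intRd; apply/funext => y; rewrite mulr_suml; congr EFin.
  by apply: eq_bigr => b _; rewrite mulrA.
- move=> a aN; rewrite [LHS]/mut /int_mu; congr intRd; apply/funext => x.
  (* The exponent is [g] by [gE]; each [mut b] is finite, so [fine] returns [A b]. *)
  congr (_ * expR (- _))%:E; rewrite gE; congr (_ * _).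
  by apply: eq_bigr => b _; rewrite mutE.
Qed.
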